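(* Let $(H,\alpha)$ be a monoidal Hom-Hopf algebra and $(A,\beta)$ a Hom-algebra. Assume that $H$ weakly acts on $A$ via $h\otimes a\mapsto h\cdot a$, and let $\sigma:H\otimes H\to A$ be a convolution invertible $k$-linear map. Let $A\#_{\sigma}H$ be the vector space $A\otimes H$ (with $a\# h:=a\otimes h$) with multiplication $$(a\#h)(b\#k)=\sum a\big[(\alpha^{-1}(h_{1})\cdot\beta^{-2}(b))\,\sigma(h_{21},\alpha^{-1}(k_{1}))\big]\#\alpha^{2}(h_{22})\alpha(k_{2}).$$ Then $(A\#_{\sigma}H,\beta\otimes\alpha)$ is a (unital) Hom-associative algebra with identity $1\#1$ if and only if the following conditions hold: (1) $A$ is a twisted $H$-module, that is, $1\cdot a=\beta(a)$ for all $a\in A$, and $$\sum(\alpha(h_{1})\cdot(l_{1}\cdot \beta^{-1}(a)))\,\sigma(\alpha(h_{2}),\alpha(l_{2}))=\sum\sigma(\alpha(h_{1}),\alpha(l_{1}))\,(h_{2}l_{2}\cdot a)$$ for all $h,l\in H$ and $a\in A$; (2) $\sigma(1,h)=\sigma(h,1)=\varepsilon(h)1$ for all $h\in H$, and $$\sum (\alpha(h_{1})\cdot\sigma(l_{1}, k_{1}))\,\sigma(\alpha(h_{2}),l_{2}k_{2})=\sum\sigma(\alpha(h_{1}),\alpha(l_{1}))\,\sigma(h_{2}l_{2},k)$$ for all $h,k,l\in H$; (3) $\sigma\circ(\alpha\otimes\alpha)=\beta\circ\sigma$.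
   Context: All vector spaces, tensor products and linear maps are over a fixed field $k$. Sweedler notation: $\Delta(h)=\sum h_1\otimes h_2$, $\sum h_1\otimes\Delta(h_2)=\sum h_1\otimes h_{21}\otimes h_{22}$, $\sum \Delta(h_1)\otimes h_2=\sum h_{11}\otimes h_{12}\otimes h_2$, etc. A (unital Hom-associative) Hom-algebra $(A,\beta)$ is a vector space $A$ with a linear automorphism $\beta$, an element $1=1_A\in A$ and a linear map $A\otimes A\to A$, $a\otimes b\mapsto ab$, such that $\beta(a)(bc)=(ab)\beta(c)$, $a1=\beta(a)=1a$, $\beta(ab)=\beta(a)\beta(b)$, $\beta(1)=1$. The element $1$ is called the identity (unit). A Hom-coalgebra $(C,\gamma)$ is a vector space with a linear automorphism $\gamma$ and linear maps $\Delta:C\to C\otimes C$, $\varepsilon:C\to k$ such that $\sum\gamma^{-1}(c_1)\otimes\Delta(c_2)=\sum\Delta(c_1)\otimes\gamma^{-1}(c_2)$, $\sum c_1\varepsilon(c_2)=\sum\varepsilon(c_1)c_2=\gamma^{-1}(c)$, $\Delta(\gamma(c))=\sum\gamma(c_1)\otimes\gamma(c_2)$, $\varepsilon(\gamma(c))=\varepsilon(c)$. A monoidal Hom-Hopf algebra $(H,\alpha)$ is a vector space $H$ with linear automorphism $\alpha$ such that $(H,\alpha)$ is both a Hom-algebra and a Hom-coalgebra, $\Delta(gh)=\Delta(g)\Delta(h)$ (componentwise product on $H\otimes H$), $\Delta(1)=1\otimes1$, $\varepsilon(gh)=\varepsilon(g)\varepsilon(h)$, $\varepsilon(1)=1$,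 and there is a linear map $S:H\to H$ (antipode) with $S\circ\alpha=\alpha\circ S$ and $\sum S(h_1)h_2=\varepsilon(h)1=\sum h_1S(h_2)$. $H$ weakly acts on $A$ if there is a $k$-linear map $H\otimes A\to A$, $h\otimes a\mapsto h\cdot a$, with $\beta(h\cdot a)=\alpha(h)\cdot\beta(a)$, $h\cdot 1=\varepsilon(h)1$, and $h\cdot(ab)=\sum(h_1\cdot a)(h_2\cdot b)$ for all $h\in H$, $a,b\in A$. A linear map $\sigma:H\otimes H\to A$ is convolution invertible if there is a linear map $\sigma^{-1}:H\otimes H\to A$ with $\sum\sigma(h_1,l_1)\sigma^{-1}(h_2,l_2)=\varepsilon(h)\varepsilon(l)1=\sum\sigma^{-1}(h_1,l_1)\sigma(h_2,l_2)$ for all $h,l\in H$. *)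

(* Defs.v *)
From HB Require Import structures.
From mathcomp Require Import all_boot all_algebra.
From mathcomp Require Import finmap monalg boolp.

Set Implicit Arguments.
Unset Strict Implicit.
Unset Printing Implicit Defensive.

Import GRing.Theory.
Local Open Scope ring_scope.
Local Open Scope quotient_scope.

(* The tensor product of two vector spaces of arbitrary dimension: the free   *)
(* vector space {malg k[V * W]} modulo the subspace spanned by the            *)
(* bilinearity relations.                                                     *)

Section TensorRelations.
Variables (k : fieldType) (V W : lmodType k).
Local Notation free := {malg k[(V * W)%type]}.

Inductive tensor_null : free -> Prop :=
| TNull0 : tensor_null 0
| TNullD x y : tensor_null x -> tensor_null y -> tensor_null (x + y)
| TNullZ c x : tensor_null x -> tensor_null (c *: x)
| TNullDl v v' w :
    tensor_null (<< (v + v', w) >> - << (v, w) >> - << (v', w) >>)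
| TNullDr v w w' :
    tensor_null (<< (v, w + w') >> - << (v, w) >> - << (v, w') >>)
| TNullZl c v w : tensor_null (<< (c *: v, w) >> - c *: << (v, w) >>)
| TNullZr c v w : tensor_null (<< (v, c *: w) >> - c *: << (v, w) >>).

Definition tensor_rel : {pred free} := fun x => `[< tensor_null x >].

Fact tensor_rel_zmod_closed : zmod_closed tensor_rel.
Proof.
split=> [|x y /asboolP nx /asboolP ny]; apply/asboolP; first exact: TNull0.
by apply: TNullD nx _; rewrite -scaleN1r; apply: TNullZ.
Qed.

HB.instance Definition _ :=
  GRing.isZmodClosed.Build free tensor_rel tensor_rel_zmod_closed.

Definition tensor := Quotient.quot tensor_rel.

HB.instance Definition _ := ZmodQuotient.on tensor.

Lemma tensor_eqP (x y : free) :
  reflect (\pi_tensor x = \pi_tensor y) (x - y \in tensor_rel).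
Proof.
rewrite -[_ \in _]Quotient.equivE.
by apply: (iffP idP) => [?|/eqmodP//]; apply/eqmodP.
Qed.

Definition tensor_scale (c : k) (t : tensor) : tensor :=
  \pi_tensor (c *: repr t).

Lemma tensor_scale_pi c x : tensor_scale c (\pi_tensor x) = \pi_tensor (c *: x).
Proof.
apply/tensor_eqP; rewrite -scalerBr.
have /tensor_eqP/asboolP nx :
    \pi_tensor (repr (\pi_tensor x)) = \pi_tensor x by rewrite reprK.
by apply/asboolP; apply: TNullZ; exact: nx.
Qed.

Fact tensor_scaleA a b t :
  tensor_scale a (tensor_scale b t) = tensor_scale (a * b) t.
Proof.
elim/quotW: t => x.
rewrite (tensor_scale_pi b) (tensor_scale_pi a) (tensor_scale_pi (a * b)).
by rewrite scalerA.
Qed.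

Fact tensor_scale1 : left_id 1 tensor_scale.
Proof. by elim/quotW=> x; rewrite tensor_scale_pi scale1r. Qed.

Fact tensor_scaleDr : right_distributive tensor_scale +%R.
Proof.
move=> c; elim/quotW=> x; elim/quotW=> y.
by rewrite -raddfD !tensor_scale_pi scalerDr raddfD.
Qed.

Fact tensor_scaleDl t : {morph tensor_scale^~ t : a b / a + b}.
Proof.
move=> a b; elim/quotW: t => x.
by rewrite !tensor_scale_pi scalerDl raddfD.
Qed.

HB.instance Definition _ := GRing.Zmodule_isLmodule.Build k tensor
  tensor_scaleA tensor_scale1 tensor_scaleDr tensor_scaleDl.

Lemma tensor_piZ c x : \pi_tensor (c *: x) = c *: \pi_tensor x.
Proof. by rewrite -tensor_scale_pi. Qed.

Definition tens (v : V) (w : W) : tensor := \pi_tensor << (v, w) >>.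

Fact tens_is_bilinear : bilinear_for *:%R *:%R tens.
Proof.
split=> [w c v v' | v c w w']; rewrite /tens /= -tensor_piZ -raddfD /=.
  transitivity (\pi_tensor (<< (c *: v, w) >> + << (v', w) >>)).
    by apply/tensor_eqP/asboolP; rewrite opprD addrA; exact: TNullDl.
  apply/tensor_eqP/asboolP; rewrite opprD addrACA subrr addr0.
  exact: TNullZl.
transitivity (\pi_tensor (<< (v, c *: w) >> + << (v, w') >>)).
  by apply/tensor_eqP/asboolP; rewrite opprD addrA; exact: TNullDr.
apply/tensor_eqP/asboolP; rewrite opprD addrACA subrr addr0.
exact: TNullZr.
Qed.

HB.instance Definition _ :=
  bilinear_isBilinear.Build k V W tensor *:%R *:%R tens tens_is_bilinear.

(* A finite expression of t as a sum of pure tensors, chosen once and for all *)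
(* as in Sweedler's convention.  The value depends on that choice unless f is *)
(* bilinear, in which case sweedler f is the linear map that f induces on     *)
(* V ⊗ W (sweedler_tens, sweedler_is_linear, sweedler_unique).                *)
Definition sweedler (U : lmodType k) (f : V -> W -> U) (t : tensor) : U :=
  \sum_(p <- msupp (repr t)) (repr t)@_p *: f p.1 p.2.

End TensorRelations.

Arguments tensor {k} (V W)%_type.

Notation "V ⊗ W" := (tensor V W)
  (at level 40, left associativity) : type_scope.
Notation "v ⊗ w" := (tens v w) (at level 40, left associativity) : ring_scope.
Notation "\sw_ ( x ⊗ y <- t ) E" := (sweedler (fun x y => E) t)
  (at level 41, x name, y name, t at level 50, E at level 41,
   format "\sw_ ( x  ⊗  y  <-  t )  E") : ring_scope.

Section TensorTheory.
Variables (k : fieldType) (V W U : lmodType k).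
Local Notation free := {malg k[(V * W)%type]}.
Implicit Types (f : V -> W -> U) (t : V ⊗ W).

Let ev f (x : free) : U := \sum_(p <- msupp x) x@_p *: f p.1 p.2.

Let evw f (d : {fset V * W}) (x : free) : (msupp x `<=` d)%fset ->
  ev f x = \sum_(p <- d) x@_p *: f p.1 p.2.
Proof.
move=> xd; rewrite /ev (big_fset_incl _ xd) // => p _ /mcoeff_outdom ->.
by rewrite scale0r.
Qed.

Let evD f x y : ev f (x + y) = ev f x + ev f y.
Proof.
rewrite (evw f (msuppD_le x y)) (evw f (fsubsetUl (msupp x) (msupp y))).
rewrite (evw f (fsubsetUr (msupp x) (msupp y))) -big_split /=.
by apply: eq_bigr => p _; rewrite mcoeffD scalerDl.
Qed.

Let evZ f c x : ev f (c *: x) = c *: ev f x.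
Proof.
rewrite (evw f (msuppZ_le c x)) /ev scaler_sumr.
by apply: eq_bigr => p _; rewrite mcoeffZ scalerA.
Qed.

Let evN f x : ev f (- x) = - ev f x.
Proof.
by apply/eqP; rewrite -addr_eq0 -evD addNr /ev msupp0 big_seq_fset0.
Qed.

Let evU f v w : ev f << (v, w) >> = f v w.
Proof. by rewrite (evw f msuppU_le) big_seq_fset1 mcoeffUU scale1r. Qed.

Let ev_null f x : bilinear_for *:%R *:%R f -> tensor_null x -> ev f x = 0.
Proof.
move=> [fl fr]; elim=> [|y z _ yE _ zE|c y _ yE|v v' w|v w w'|c v w|c v w].
- by rewrite /ev msupp0 big_seq_fset0.
- by rewrite evD yE zE addr0.
- by rewrite evZ yE scaler0.
- have := fl w 1 v v'; rewrite /= !scale1r => E.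
  by rewrite !(evD, evN, evU) E -addrA -opprD subrr.
- have := fr v 1 w w'; rewrite /= !scale1r => E.
  by rewrite !(evD, evN, evU) E -addrA -opprD subrr.
- have f0 : f 0 w = 0.
    by have := fl w (-1) 0 0; rewrite /= scaler0 addr0 scaleN1r addNr.
  have := fl w c v 0; rewrite /= f0 !addr0 => E.
  by rewrite evD evN evZ !evU E subrr.
- have f0 : f v 0 = 0.
    by have := fr v (-1) 0 0; rewrite /= scaler0 addr0 scaleN1r addNr.
  have := fr v c w 0; rewrite /= f0 !addr0 => E.
  by rewrite evD evN evZ !evU E subrr.
Qed.

Let sweedler_pi f x : bilinear_for *:%R *:%R f ->
  sweedler f (\pi_(V ⊗ W) x) = ev f x.
Proof.
move=> fB; apply/eqP; rewrite -subr_eq0 -[sweedler _ _]/(ev _ _) -evN -evD.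
apply/eqP/(ev_null fB)/asboolP.
by apply/tensor_eqP; rewrite reprK.
Qed.

Lemma sweedler_tens f v w :
  bilinear_for *:%R *:%R f -> sweedler f (v ⊗ w) = f v w.
Proof. by move=> fB; rewrite sweedler_pi // evU. Qed.

Lemma sweedler_is_linear f :
  bilinear_for *:%R *:%R f -> linear (sweedler f : V ⊗ W -> U).
Proof.
move=> fB c; elim/quotW=> x; elim/quotW=> y.
by rewrite -tensor_piZ -raddfD !sweedler_pi // evD evZ.
Qed.

Lemma tensor_ind (P : V ⊗ W -> Prop) :
    (forall c s t, P s -> P t -> P (c *: s + t)) ->
    (forall v w, P (v ⊗ w)) ->
  forall t, P t.
Proof.
move=> Plin Ptens.
have P0 : P 0 by rewrite -(addNr (0 ⊗ 0)) -scaleN1r; apply: Plin.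
elim/quotW=> x; rewrite [x]monalgE.
elim: (enum_fset (msupp x)) => [|[v w] s IHs]; first by rewrite big_nil raddf0.
rewrite big_cons raddfD /=.
have -> : << x@_(v, w) *g (v, w) >> = x@_(v, w) *: << (v, w) >> :> free.
  by apply/malgP => q; rewrite mcoeffZ !mcoeffU mulr_natr.
by rewrite tensor_piZ; apply: Plin; [apply: Ptens|].
Qed.

Lemma tensor_ext (f g : {linear (V ⊗ W)%type -> U}) :
  (forall v w, f (v ⊗ w) = g (v ⊗ w)) -> f =1 g.
Proof.
by move=> fg t; elim/tensor_ind: t => [c s t sE tE|//]; rewrite !linearP sE tE.
Qed.

Lemma sweedler_unique f (g : {linear (V ⊗ W)%type -> U}) :
    bilinear_for *:%R *:%R f -> (forall v w, g (v ⊗ w) = f v w) ->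
  sweedler f =1 g.
Proof.
move=> fB gE t; pose sf : {linear (V ⊗ W)%type -> U} :=
  HB.pack (sweedler f) (GRing.isLinear.Build _ _ _ _ _ (sweedler_is_linear fB)).
by apply: (tensor_ext (f := sf)) => v w; rewrite gE [LHS]sweedler_tens.
Qed.

Lemma eq_sweedler f g t : (forall v w, f v w = g v w) ->
  sweedler f t = sweedler g t.
Proof. by move=> fg; apply: eq_bigr => p _; rewrite fg. Qed.

Lemma sweedlerP c f g t :
  \sw_(v ⊗ w <- t) (c *: f v w + g v w) = c *: sweedler f t + sweedler g t.
Proof.
rewrite scaler_sumr -big_split; apply: eq_bigr => p _ /=.
by rewrite scalerDr !scalerA mulrC.
Qed.

Lemma sweedler_linear_param (X : lmodType k) (F : X -> V -> W -> U) t :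
  (forall v w, linear (fun x => F x v w)) -> linear (fun x => sweedler (F x) t).
Proof.
by move=> Flin c x y; rewrite -sweedlerP; apply: eq_sweedler => v w; apply: Flin.
Qed.

Lemma sweedler_linear_arg (X : lmodType k) f (g : {linear X -> (V ⊗ W)%type}) :
  bilinear_for *:%R *:%R f -> linear (fun x => sweedler f (g x)).
Proof. by move=> fB c x y; rewrite linearP sweedler_is_linear. Qed.

End TensorTheory.

Lemma linear_sweedler (k : fieldType) (V W U U' : lmodType k)
    (g : {linear U -> U'}) (f : V -> W -> U) (t : V ⊗ W) :
  g (sweedler f t) = \sw_(v ⊗ w <- t) g (f v w).
Proof. by rewrite linear_sum; apply: eq_bigr => p _; rewrite linearZ. Qed.

Section TensorMap.
Variables (k : fieldType) (V V' W W' : lmodType k).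
Variables (f : {linear V -> V'}) (g : {linear W -> W'}).

Definition tensor_map (t : V ⊗ W) : V' ⊗ W' := \sw_(v ⊗ w <- t) (f v ⊗ g w).

Fact tensor_map_bilinear :
  bilinear_for *:%R *:%R (fun v w => f v ⊗ g w).
Proof.
by split=> [w c v v' | v c w w'] /=; rewrite linearP ?linearPl ?linearPr.
Qed.

HB.instance Definition _ := GRing.isLinear.Build k (V ⊗ W)%type (V' ⊗ W')%type _
  tensor_map (sweedler_is_linear tensor_map_bilinear).

Lemma tensor_mapE v w : tensor_map (v ⊗ w) = f v ⊗ g w.
Proof. exact: sweedler_tens tensor_map_bilinear. Qed.

End TensorMap.

Record linear_automorphism (k : fieldType) (V : lmodType k) := LinAut {
  aut_fun :> {linear V -> V};
  aut_inv : {linear V -> V};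
  autK : cancel aut_fun aut_inv;
  autVK : cancel aut_inv aut_fun
}.

Arguments linear_automorphism {k} V%_type.

Notation "f ^{-1}" := (aut_inv f) (at level 2, format "f ^{-1}").

Section TensorAut.
Variables (k : fieldType) (V W : lmodType k).
Variables (f : linear_automorphism V) (g : linear_automorphism W).

Fact tensor_mapK : cancel (tensor_map f g) (tensor_map f^{-1} g^{-1}).
Proof.
elim/tensor_ind=> [c s t sE tE|v w]; first by rewrite !linearP /= sE tE.
by rewrite !tensor_mapE !autK.
Qed.

Fact tensor_mapVK : cancel (tensor_map f^{-1} g^{-1}) (tensor_map f g).
Proof.
elim/tensor_ind=> [c s t sE tE|v w]; first by rewrite !linearP /= sE tE.
by rewrite !tensor_mapE !autVK.
Qed.

Definition tensor_aut : linear_automorphism (V ⊗ W) :=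
  LinAut tensor_mapK tensor_mapVK.

End TensorAut.

Record hom_algebra (k : fieldType) (A : lmodType k)
    (beta : linear_automorphism A) (mul : {linear (A ⊗ A)%type -> A})
    (one : A) : Prop := HomAlgebraAxioms {
  hom_mulA : forall a b c,
    mul (beta a ⊗ mul (b ⊗ c)) = mul (mul (a ⊗ b) ⊗ beta c);
  hom_mul1r : forall a, mul (a ⊗ one) = beta a;
  hom_mul1l : forall a, mul (one ⊗ a) = beta a;
  hom_autM : forall a b, beta (mul (a ⊗ b)) = mul (beta a ⊗ beta b);
  hom_aut1 : beta one = one
}.

Record hom_coalgebra (k : fieldType) (C : lmodType k)
    (gamma : linear_automorphism C) (Delta : {linear C -> (C ⊗ C)%type})
    (epsilon : {scalar C}) : Prop := HomCoalgebraAxioms {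
  hom_comulA : forall c,
    \sw_(c1 ⊗ c2 <- Delta c) \sw_(c21 ⊗ c22 <- Delta c2)
      (gamma^{-1} c1 ⊗ (c21 ⊗ c22)) =
    \sw_(c1 ⊗ c2 <- Delta c) \sw_(c11 ⊗ c12 <- Delta c1)
      (c11 ⊗ (c12 ⊗ gamma^{-1} c2));
  hom_counitr : forall c,
    \sw_(c1 ⊗ c2 <- Delta c) (epsilon c2 *: c1) = gamma^{-1} c;
  hom_counitl : forall c,
    \sw_(c1 ⊗ c2 <- Delta c) (epsilon c1 *: c2) = gamma^{-1} c;
  hom_comul_aut : forall c,
    Delta (gamma c) = \sw_(c1 ⊗ c2 <- Delta c) (gamma c1 ⊗ gamma c2);
  hom_counit_aut : forall c, epsilon (gamma c) = epsilon c
}.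

Record homAlgType (k : fieldType) := HomAlg {
  hom_sort :> lmodType k;
  hom_aut : linear_automorphism hom_sort;
  hom_mul : {linear (hom_sort ⊗ hom_sort)%type -> hom_sort};
  hom_one : hom_sort;
  hom_algebraP : hom_algebra hom_aut hom_mul hom_one
}.

Arguments hom_aut {k} A : rename.
Arguments hom_mul {k A} : rename.
Arguments hom_one {k} A : rename.

Notation "a ∙ b" := (@hom_mul _ _ (a ⊗ b))
  (at level 39, left associativity).

Record monoidalHomHopfType (k : fieldType) := MonoidalHomHopf {
  hopf_alg :> homAlgType k;
  hopf_comul : {linear hopf_alg -> (hopf_alg ⊗ hopf_alg)%type};
  hopf_counit : {scalar hopf_alg};
  hopf_coalgebraP : hom_coalgebra (hom_aut hopf_alg) hopf_comul hopf_counit;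
  hopf_comulM : forall g h : hopf_alg,
    hopf_comul (g ∙ h) =
    \sw_(g1 ⊗ g2 <- hopf_comul g) \sw_(h1 ⊗ h2 <- hopf_comul h)
      ((g1 ∙ h1) ⊗ (g2 ∙ h2));
  hopf_comul1 : hopf_comul (hom_one hopf_alg) =
    hom_one hopf_alg ⊗ hom_one hopf_alg;
  hopf_counitM : forall g h : hopf_alg,
    hopf_counit (g ∙ h) = hopf_counit g * hopf_counit h;
  hopf_counit1 : hopf_counit (hom_one hopf_alg) = 1;
  hopf_antipode : exists S : {linear hopf_alg -> hopf_alg},
    [/\ forall h, S (hom_aut hopf_alg h) = hom_aut hopf_alg (S h),
        forall h, \sw_(h1 ⊗ h2 <- hopf_comul h) (S h1 ∙ h2) =
                  hopf_counit h *: hom_one hopf_alg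
      & forall h, \sw_(h1 ⊗ h2 <- hopf_comul h) (h1 ∙ S h2) =
                  hopf_counit h *: hom_one hopf_alg]
}.

Notation Δ := (@hopf_comul _ _).
Notation ε := (@hopf_counit _ _).

Section CrossedProduct.
Variables (k : fieldType) (H : monoidalHomHopfType k) (A : homAlgType k).
Local Notation α := (hom_aut H).
Local Notation β := (hom_aut A).
Local Notation "1_ V" := (hom_one V) (at level 8, format "1_ V").

Definition weak_action (act : {linear (H ⊗ A)%type -> A}) : Prop :=
  [/\ forall h a, β (act (h ⊗ a)) = act (α h ⊗ β a),
      forall h, act (h ⊗ 1_A) = ε h *: 1_A
    & forall h a b,
        act (h ⊗ (a ∙ b)) = \sw_(h1 ⊗ h2 <- Δ h) (act (h1 ⊗ a) ∙ act (h2 ⊗ b))].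

Definition convolution_invertible (sigma : {linear (H ⊗ H)%type -> A}) : Prop :=
  exists tau : {linear (H ⊗ H)%type -> A}, forall h l : H,
    \sw_(h1 ⊗ h2 <- Δ h) \sw_(l1 ⊗ l2 <- Δ l)
      (sigma (h1 ⊗ l1) ∙ tau (h2 ⊗ l2)) = (ε h * ε l) *: 1_A /\
    \sw_(h1 ⊗ h2 <- Δ h) \sw_(l1 ⊗ l2 <- Δ l)
      (tau (h1 ⊗ l1) ∙ sigma (h2 ⊗ l2)) = (ε h * ε l) *: 1_A.

Variables (act : {linear (H ⊗ A)%type -> A}).
Variables (sigma : {linear (H ⊗ H)%type -> A}).

Definition twisted_module : Prop :=
  (forall a : A, act (1_H ⊗ a) = β a) /\
  forall (h l : H) (a : A),
    \sw_(h1 ⊗ h2 <- Δ h) \sw_(l1 ⊗ l2 <- Δ l)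
      (act (α h1 ⊗ act (l1 ⊗ β^{-1} a)) ∙ sigma (α h2 ⊗ α l2)) =
    \sw_(h1 ⊗ h2 <- Δ h) \sw_(l1 ⊗ l2 <- Δ l)
      (sigma (α h1 ⊗ α l1) ∙ act ((h2 ∙ l2) ⊗ a)).

Definition normal_cocycle : Prop :=
  (forall h : H, sigma (1_H ⊗ h) = ε h *: 1_A /\
                 sigma (h ⊗ 1_H) = ε h *: 1_A) /\
  forall h l m : H,
    \sw_(h1 ⊗ h2 <- Δ h) \sw_(l1 ⊗ l2 <- Δ l) \sw_(m1 ⊗ m2 <- Δ m)
      (act (α h1 ⊗ sigma (l1 ⊗ m1)) ∙ sigma (α h2 ⊗ (l2 ∙ m2))) =
    \sw_(h1 ⊗ h2 <- Δ h) \sw_(l1 ⊗ l2 <- Δ l)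
      (sigma (α h1 ⊗ α l1) ∙ sigma ((h2 ∙ l2) ⊗ m)).

(* (a # h)(b # l), with # written ⊗ *)
Definition crossed_formula (a : A) (h : H) (b : A) (l : H) : A ⊗ H :=
  \sw_(h1 ⊗ h2 <- Δ h) \sw_(h21 ⊗ h22 <- Δ h2) \sw_(l1 ⊗ l2 <- Δ l)
    ((a ∙ (act (α^{-1} h1 ⊗ β^{-1} (β^{-1} b)) ∙ sigma (h21 ⊗ α^{-1} l1)))
     ⊗ (α (α h22) ∙ α l2)).

Definition crossed_mul (t : (A ⊗ H) ⊗ (A ⊗ H)) : A ⊗ H :=
  \sw_(x ⊗ y <- t) \sw_(a ⊗ h <- x) \sw_(b ⊗ l <- y) crossed_formula a h b l.

Fact crossed_formula_linear_a h b l :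
  linear (fun a => crossed_formula a h b l).
Proof.
do 3 (apply: sweedler_linear_param => ? ?); move=> c x y.
by rewrite linearPl linearP linearPl.
Qed.

Fact crossed_formula_linear_b a h l :
  linear (fun b => crossed_formula a h b l).
Proof.
do 3 (apply: sweedler_linear_param => ? ?); move=> c x y.
by do ?[rewrite linearP | rewrite linearPl | rewrite linearPr].
Qed.

Fact crossed_formula_linear_l a h b :
  linear (fun l => crossed_formula a h b l).
Proof.
do 2 (apply: sweedler_linear_param => ? ?).
apply: sweedler_linear_arg; split=> [? c x y | ? c x y] /=;
by do ?[rewrite linearP | rewrite linearPl | rewrite linearPr].
Qed.

Fact crossed_formula_linear_h a b l :
  linear (fun h => crossed_formula a h b l).
Proof.
apply: sweedler_linear_arg; split=> [h2 | h1] /=.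
  do 2 (apply: sweedler_linear_param => ? ?); move=> c x y.
  by do ?[rewrite linearP | rewrite linearPl | rewrite linearPr].
apply: sweedler_linear_arg; split=> [? | ?] /=;
  apply: sweedler_linear_param => ? ?; move=> c x y;
  by do ?[rewrite linearP | rewrite linearPl | rewrite linearPr].
Qed.

Fact crossed_mul_bilinear : bilinear_for *:%R *:%R (fun x y : A ⊗ H =>
  \sw_(a ⊗ h <- x) \sw_(b ⊗ l <- y) crossed_formula a h b l).
Proof.
split=> [y | x].
  apply: sweedler_is_linear; split=> [h | a] /=;
    apply: sweedler_linear_param => b l.
    exact: crossed_formula_linear_a.
  exact: crossed_formula_linear_h.
apply: sweedler_linear_param => a h; apply: sweedler_is_linear.
split=> [l | b]; first exact: crossed_formula_linear_b.
exact: crossed_formula_linear_l.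
Qed.

HB.instance Definition _ := GRing.isLinear.Build k
  ((A ⊗ H) ⊗ (A ⊗ H))%type (A ⊗ H)%type _
  crossed_mul (sweedler_is_linear crossed_mul_bilinear).

Lemma crossed_mulE a h b l :
  crossed_mul ((a ⊗ h) ⊗ (b ⊗ l)) = crossed_formula a h b l.
Proof.
rewrite [LHS](sweedler_tens _ _ crossed_mul_bilinear) sweedler_tens.
  rewrite sweedler_tens //.
  split=> [? | ?]; first exact: crossed_formula_linear_b.
  exact: crossed_formula_linear_l.
split=> [h' | a'] /=; apply: sweedler_linear_param => b' l'.
  exact: crossed_formula_linear_a.
exact: crossed_formula_linear_h.
Qed.

End CrossedProduct.

(* Main.v *)
From HB Require Import structures.
Require Import Defs.
From mathcomp Require Import all_boot all_algebra.
Import GRing.Theory.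
Local Open Scope ring_scope.
Set Implicit Arguments.
Unset Strict Implicit.
Unset Printing Implicit Defensive.

(** The proof removes the Hom-twist from every structure and then proves the
    classical theorem on crossed products of a bialgebra with an algebra.

    If (V, f) is a Hom-algebra, then f^-1(ab) is an associative product with
    the same unit, and f is an automorphism of it; conversely, twisting an
    associative unital product by an automorphism gives a Hom-algebra
    (untwist_algebraP).  Likewise (α ⊗ α) ∘ Δ is an ordinary comultiplication,
    so H becomes an ordinary bialgebra with automorphism α (hopf_bialgebra),
    h ▹ a = β^-1(h · a) is an ordinary weak action, and with
    τ = β ∘ σ ∘ (α^-2 ⊗ α^-2) the multiplication of A #_σ H becomes
      (a # h)(b # l) = Σ a (h_1 ▹ b) τ(h_2, l_1) # h_3 l_2,
    followed by β ⊗ α (untwisted_crossed_mulE).  Hence A #_σ H is a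
    Hom-algebra if and only if this product is associative and unital and
    β ⊗ α is multiplicative for it.

    The classical theorem (crossed_product_assocP) runs as follows.  Both
    bracketings of a triple product expand to explicit sums
    (crossed_mulAl, crossed_mulAr); the twisted module identity and the
    cocycle identity, applied inside these sums after regrouping by
    coassociativity (twisted_tail, cocycle_tail), carry one into the other.
    Conversely, applying id ⊗ ε to associativity of (1#h)(1#l)(a#1) and of
    (1#h)(1#l)(1#m), and to the unit laws, returns exactly the module,
    cocycle and normalization identities.  Multiplicativity of β ⊗ α amounts
    to β ∘ τ = τ ∘ (α ⊗ α) (crossed_endoP), that is, to
    σ ∘ (α ⊗ α) = β ∘ σ (untwisted_cocycle_autP); under this equivariance the
    Hom-versions of the identities are β^2 applied to the ordinary ones
    (twisted_moduleP, normal_cocycleP). *)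

(** * Sums over tensors *)

(** Sealed copies of sweedler and of the pure tensor.  Their values depend on
    chosen representatives of classes in a quotient; sealing keeps unification
    from unfolding two different sums or tensors down to those choices. *)

HB.lock Definition tsum (k : fieldType) (V W U : lmodType k)
  (f : V -> W -> U) (t : V ⊗ W) : U := sweedler f t.

Notation "\tsum_ ( x ⊗ y <- t ) E" := (tsum (fun x y => E) t)
  (at level 41, x name, y name, t at level 50, E at level 41,
   format "\tsum_ ( x  ⊗  y  <-  t )  E") : ring_scope.

HB.lock Definition pure (k : fieldType) (V W : lmodType k) (v : V) (w : W) :
  V ⊗ W := v ⊗ w.

Notation "v ⊠ w" := (pure v w)
  (at level 40, left associativity) : ring_scope.

Section Linearity.
Variables (k : fieldType) (V W U X Y : lmodType k).

Lemma linear_id : linear (fun x : X => x).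
Proof. by []. Qed.

Lemma linear_comp (f : {linear U -> V}) (g : X -> U) :
  linear g -> linear (fun x => f (g x)).
Proof. by move=> gL c x y; rewrite gL linearP. Qed.

Lemma linear_compf (f : U -> V) (g : X -> U) :
  linear f -> linear g -> linear (fun x => f (g x)).
Proof. by move=> fL gL c x y; rewrite gL fL. Qed.

Lemma linear_tensl (g : X -> V) (w : W) :
  linear g -> linear (fun x => g x ⊠ w).
Proof. by move=> gL c x y; rewrite pure.unlock gL linearPl. Qed.

Lemma linear_tensr (v : V) (g : X -> W) :
  linear g -> linear (fun x => v ⊠ g x).
Proof. by move=> gL c x y; rewrite pure.unlock gL linearPr. Qed.

Lemma linear_scale (c : k) (g : X -> V) :
  linear g -> linear (fun x => c *: g x).
Proof. by move=> gL d x y; rewrite gL scalerDr !scalerA mulrC. Qed.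

Lemma linear_scalar (e : {scalar U}) (g : X -> U) (v : V) :
  linear g -> linear (fun x => e (g x) *: v).
Proof. by move=> gL c x y; rewrite gL linearP scalerDl scalerA. Qed.

Lemma linear_tsum_arg (f : V -> W -> U) (g : X -> V ⊗ W) :
    (forall w, linear (fun v => f v w)) -> (forall v, linear (f v)) ->
  linear g -> linear (fun x => tsum f (g x)).
Proof.
by move=> fl fr gL c x y; rewrite tsum.unlock gL sweedler_is_linear.
Qed.

Lemma linear_tsum_param (F : X -> V -> W -> U) t :
  (forall v w, linear (fun x => F x v w)) -> linear (fun x => tsum (F x) t).
Proof. by rewrite tsum.unlock; apply: sweedler_linear_param. Qed.

Lemma eq_tsum (f g : V -> W -> U) t :
  (forall v w, f v w = g v w) -> tsum f t = tsum g t.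
Proof. by rewrite tsum.unlock; apply: eq_sweedler. Qed.

Lemma tsum_pure (f : V -> W -> U) v w :
    (forall w, linear (fun v => f v w)) -> (forall v, linear (f v)) ->
  \tsum_(x ⊗ y <- v ⊠ w) f x y = f v w.
Proof. by move=> fl fr; rewrite pure.unlock tsum.unlock sweedler_tens. Qed.

Lemma exchange_tsum (f : V -> W -> X -> Y -> U) s t :
  \tsum_(v ⊗ w <- s) \tsum_(x ⊗ y <- t) f v w x y =
  \tsum_(x ⊗ y <- t) \tsum_(v ⊗ w <- s) f v w x y.
Proof.
rewrite tsum.unlock /sweedler; under eq_bigr => p _ do rewrite scaler_sumr.
rewrite exchange_big; apply: eq_bigr => q _; rewrite scaler_sumr.
by apply: eq_bigr => p _; rewrite !scalerA mulrC.
Qed.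

Lemma linear_tsumE (g : U -> X) (f : V -> W -> U) t :
  linear g -> g (tsum f t) = \tsum_(v ⊗ w <- t) g (f v w).
Proof.
move=> gL; pose h : {linear U -> X} :=
  HB.pack g (GRing.isLinear.Build _ _ _ _ _ gL).
rewrite tsum.unlock; exact: (linear_sweedler h).
Qed.

End Linearity.

(** Iterated sums whose tensors do not depend on the outer indices; these are
    the shapes of the two sides of the module and cocycle identities. *)
Section LinearIteratedSums.
Variables (k : fieldType) (V W V' W' V2 W2 U X : lmodType k).
Variables (g : U -> X) (gL : linear g).

Lemma linear_tsumE2 (f : V -> W -> V' -> W' -> U) s t :
  g (\tsum_(v ⊗ w <- s) \tsum_(v' ⊗ w' <- t) f v w v' w') =
  \tsum_(v ⊗ w <- s) \tsum_(v' ⊗ w' <- t) g (f v w v' w').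
Proof.
by rewrite (linear_tsumE _ _ gL); apply: eq_tsum => ? ?; rewrite linear_tsumE.
Qed.

Lemma linear_tsumE3 (f : V -> W -> V' -> W' -> V2 -> W2 -> U) s t r :
  g (\tsum_(v ⊗ w <- s) \tsum_(v' ⊗ w' <- t) \tsum_(x ⊗ y <- r)
       f v w v' w' x y) =
  \tsum_(v ⊗ w <- s) \tsum_(v' ⊗ w' <- t) \tsum_(x ⊗ y <- r)
    g (f v w v' w' x y).
Proof.
rewrite (linear_tsumE _ _ gL); apply: eq_tsum => ? ?.
by rewrite (linear_tsumE _ _ gL); apply: eq_tsum => ? ?; rewrite linear_tsumE.
Qed.

End LinearIteratedSums.

(** Proves linearity of an expression in one variable by following the unique
    path from the root of the expression to that variable.  Each branch names
    the maps on both sides of the path, since leaving them to higher-order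
    unification is ambiguous; the last branches serve families of maps whose
    partial linearity is a hypothesis. *)
Ltac lin :=
  intros;
  lazymatch goal with
  | |- GRing.linear_for _ ?f =>
    let f := eval cbv beta in f in
    lazymatch f with
    | fun x => x => exact: linear_id
    | fun x => ?v ⊠ ?w =>
      first
      [ lazymatch f with fun x => @?g x ⊠ _ =>
          refine (@linear_tensl _ _ _ _ g w _) end
      | lazymatch f with fun x => _ ⊠ @?g x =>
          refine (@linear_tensr _ _ _ _ v g _) end ]; lin
    | fun x => tsum ?F ?t =>
      first
      [ lazymatch f with fun x => tsum (@?F x) _ =>
          refine (@linear_tsum_param _ _ _ _ _ F t _) end
      | lazymatch f with fun x => tsum _ (@?g x) =>
          refine (@linear_tsum_arg _ _ _ _ _ F g _ _ _) end ]; lin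
    | fun x => ?c *: ?v =>
      first
      [ lazymatch f with fun x => _ *: @?g x =>
          refine (@linear_scale _ _ _ c g _) end
      | lazymatch f with fun x => GRing.Linear.sort ?e (@?g x) *: _ =>
          refine (@linear_scalar _ _ _ _ e g v _) end ]; lin
    | fun x => tensor_map ?f1 ?f2 (@?g x) =>
      refine (@linear_comp _ _ _ _ (tensor_map f1 f2) g _); lin
    | fun x => GRing.Linear.sort ?h (@?g x) =>
      refine (@linear_comp _ _ _ _ h g _); lin
    | _ => first
      [ match goal with H : _ |- _ => apply: H end
      | lazymatch f with fun x => ?F (@?g x) ?u ?v =>
          refine (@linear_compf _ _ _ _ (fun a => F a u v) g _ _) end; lin
      | lazymatch f with fun x => ?F (@?g x) ?u =>
          refine (@linear_compf _ _ _ _ (fun a => F a u) g _ _) end; lin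
      | lazymatch f with fun x => ?F ?u (@?g x) =>
          refine (@linear_compf _ _ _ _ (F u) g _ _) end; lin ]
    end
  end.

Section PureTensors.
Variables (k : fieldType) (V W U X : lmodType k).

Lemma tsum_pure_l (f : V -> W -> U) t (x : X) :
  tsum f t ⊠ x = \tsum_(v ⊗ w <- t) (f v w ⊠ x).
Proof. by rewrite (linear_tsumE (g := fun u => u ⊠ x)) //; lin. Qed.

Lemma tsum_pure_r (f : V -> W -> U) t (x : X) :
  x ⊠ tsum f t = \tsum_(v ⊗ w <- t) (x ⊠ f v w).
Proof. by rewrite (linear_tsumE (g := fun u => x ⊠ u)) //; lin. Qed.

Lemma linear_tsum (g : {linear U -> X}) (f : V -> W -> U) t :
  g (tsum f t) = \tsum_(v ⊗ w <- t) g (f v w).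
Proof. by rewrite tsum.unlock linear_sweedler. Qed.

Lemma pure_scalel (c : k) (u : U) (x : X) : (c *: u) ⊠ x = c *: (u ⊠ x).
Proof. by rewrite pure.unlock linearZl. Qed.

Lemma pure_scaler (c : k) (u : U) (x : X) : u ⊠ (c *: x) = c *: (u ⊠ x).
Proof. by rewrite pure.unlock linearZr. Qed.

Lemma pure_ext (f g : V ⊗ W -> U) : linear f -> linear g ->
  (forall v w, f (v ⊠ w) = g (v ⊠ w)) -> f =1 g.
Proof.
move=> fL gL fg t; elim/tensor_ind: t => [c s t sE tE|v w].
  by rewrite fL gL sE tE.
by have := fg v w; rewrite pure.unlock.
Qed.

End PureTensors.

Section TensorMaps.
Variables (k : fieldType) (V V' W W' U : lmodType k).
Variables (f : {linear V -> V'}) (g : {linear W -> W'}).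

Lemma tensor_map_pure v w : tensor_map f g (v ⊠ w) = f v ⊠ g w.
Proof. by rewrite pure.unlock tensor_mapE. Qed.

Lemma tsum_tensor_map (F : V' -> W' -> U) t :
    (forall w, linear (fun v => F v w)) -> (forall v, linear (F v)) ->
  \tsum_(x ⊗ y <- tensor_map f g t) F x y = \tsum_(v ⊗ w <- t) F (f v) (g w).
Proof.
move=> F1 F2.
apply: (pure_ext (f := fun t => \tsum_(x ⊗ y <- tensor_map f g t) F x y)
  (g := fun t => \tsum_(v ⊗ w <- t) F (f v) (g w))); try lin.
by move=> v w; rewrite tensor_map_pure !tsum_pure //; lin.
Qed.

End TensorMaps.

Lemma tensE : @tens = @pure.
Proof. by rewrite pure.unlock. Qed.

Lemma sweedlerE : @sweedler = @tsum.
Proof. by rewrite tsum.unlock. Qed.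

(** * Algebras and bialgebras, and Sweedler calculus *)

Record assoc_algebra (k : fieldType) (V : lmodType k)
    (mul : {linear (V ⊗ V)%type -> V}) (one : V) : Prop := AssocAlgebra {
  assoc_mulA : forall a b c,
    mul (a ⊠ mul (b ⊠ c)) = mul (mul (a ⊠ b) ⊠ c);
  assoc_mul1l : forall a, mul (one ⊠ a) = a;
  assoc_mul1r : forall a, mul (a ⊠ one) = a
}.

Record bialgebra (k : fieldType) (V : lmodType k)
    (mul : {linear (V ⊗ V)%type -> V}) (one : V)
    (D : {linear V -> (V ⊗ V)%type}) (e : {scalar V}) : Prop := Bialgebra {
  bialg_algebra : assoc_algebra mul one;
  bialg_coassoc : forall h,
    \tsum_(x ⊗ y <- D h) \tsum_(u ⊗ v <- D x) (u ⊠ (v ⊠ y)) =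
    \tsum_(x ⊗ y <- D h) \tsum_(u ⊗ v <- D y) (x ⊠ (u ⊠ v));
  bialg_counitr : forall h, \tsum_(x ⊗ y <- D h) (e y *: x) = h;
  bialg_counitl : forall h, \tsum_(x ⊗ y <- D h) (e x *: y) = h;
  bialg_comulM : forall g h, D (mul (g ⊠ h)) =
    \tsum_(x ⊗ y <- D g) \tsum_(u ⊗ v <- D h) (mul (x ⊠ u) ⊠ mul (y ⊠ v));
  bialg_comul1 : D one = one ⊠ one;
  bialg_counitM : forall g h, e (mul (g ⊠ h)) = e g * e h;
  bialg_counit1 : e one = 1
}.

Section SweedlerCalculus.
Variables (k : fieldType) (H : lmodType k) (mH : {linear (H ⊗ H)%type -> H}).
Variables (oneH : H) (D : {linear H -> (H ⊗ H)%type}) (e : {scalar H}).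
Hypothesis Hb : bialgebra mH oneH D e.

Local Notation "h ∗ l" := (mH (h ⊠ l)) (at level 39, left associativity).

(** The functional form of coassociativity used in all computations: F induces
    a linear map on H ⊗ (H ⊗ H), which is applied to the coassociativity
    identity between tensors. *)
Lemma sweedler_coassoc (U : lmodType k) (F : H -> H -> H -> U) h :
    (forall y z, linear (fun x => F x y z)) ->
    (forall x z, linear (fun y => F x y z)) ->
    (forall x y, linear (fun z => F x y z)) ->
  \tsum_(x ⊗ y <- D h) \tsum_(u ⊗ v <- D x) F u v y =
  \tsum_(x ⊗ y <- D h) \tsum_(u ⊗ v <- D y) F x u v.
Proof.
move=> F1 F2 F3.
have /(_ h) := bialg_coassoc Hb.
pose g (t : H ⊗ (H ⊗ H)) := \tsum_(x ⊗ s <- t) \tsum_(u ⊗ v <- s) F x u v.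
have gL : linear g by rewrite /g; lin.
have gE x y z : g (x ⊠ (y ⊠ z)) = F x y z.
  by rewrite /g !tsum_pure //; lin.
(* Forgetting the body of g lets g (sum) be rewritten as it stands. *)
move: (g) gL gE => {}g gL gE /(congr1 g); rewrite !(linear_tsumE _ _ gL).
under eq_tsum => x y.
  rewrite (linear_tsumE _ _ gL); under eq_tsum => u v do rewrite gE.
  over.
move=> ->; apply: eq_tsum => x y.
by rewrite (linear_tsumE _ _ gL); apply: eq_tsum => u v; rewrite gE.
Qed.

Lemma sweedler_counitl (U : lmodType k) (F : H -> U) h :
  linear F -> \tsum_(x ⊗ y <- D h) (e x *: F y) = F h.
Proof.
move=> FL; rewrite -[in RHS](bialg_counitl Hb h) (linear_tsumE _ _ FL).
apply: eq_tsum => x y; pose f : {linear H -> U} :=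
  HB.pack F (GRing.isLinear.Build _ _ _ _ _ FL).
by rewrite -[F (_ *: _)]/(f _) linearZ.
Qed.

Lemma sweedler_counitr (U : lmodType k) (F : H -> U) h :
  linear F -> \tsum_(x ⊗ y <- D h) (e y *: F x) = F h.
Proof.
move=> FL; rewrite -[in RHS](bialg_counitr Hb h) (linear_tsumE _ _ FL).
apply: eq_tsum => x y; pose f : {linear H -> U} :=
  HB.pack F (GRing.isLinear.Build _ _ _ _ _ FL).
by rewrite -[F (_ *: _)]/(f _) linearZ.
Qed.

Lemma sweedler_comulM (U : lmodType k) (F : H -> H -> U) g h :
    (forall y, linear (fun x => F x y)) -> (forall x, linear (F x)) ->
  \tsum_(x ⊗ y <- D (g ∗ h)) F x y =
  \tsum_(x ⊗ y <- D g) \tsum_(u ⊗ v <- D h) F (x ∗ u) (y ∗ v).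
Proof.
move=> F1 F2; have FL : linear (fun t : H ⊗ H => tsum F t) by lin.
rewrite (bialg_comulM Hb) (linear_tsumE _ _ FL); apply: eq_tsum => x y.
rewrite (linear_tsumE _ _ FL); apply: eq_tsum => u v.
by rewrite tsum_pure.
Qed.

Lemma sweedler_comul1 (U : lmodType k) (F : H -> H -> U) :
    (forall y, linear (fun x => F x y)) -> (forall x, linear (F x)) ->
  \tsum_(x ⊗ y <- D oneH) F x y = F oneH oneH.
Proof. by move=> F1 F2; rewrite (bialg_comul1 Hb) tsum_pure. Qed.

(** Coassociativity of the tensor product coalgebra H ⊗ H. *)
Lemma sweedler_coassoc2 (U : lmodType k)
    (F : H -> H -> H -> H -> H -> H -> U) h l :
    (forall b c d e f, linear (fun a => F a b c d e f)) ->
    (forall a c d e f, linear (fun b => F a b c d e f)) ->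
    (forall a b d e f, linear (fun c => F a b c d e f)) ->
    (forall a b c e f, linear (fun d => F a b c d e f)) ->
    (forall a b c d f, linear (fun e => F a b c d e f)) ->
    (forall a b c d e, linear (fun f => F a b c d e f)) ->
  \tsum_(x ⊗ y <- D h) \tsum_(p ⊗ q <- D l)
    \tsum_(x1 ⊗ x2 <- D x) \tsum_(p1 ⊗ p2 <- D p) F x1 p1 x2 p2 y q =
  \tsum_(x ⊗ y <- D h) \tsum_(p ⊗ q <- D l)
    \tsum_(y1 ⊗ y2 <- D y) \tsum_(q1 ⊗ q2 <- D q) F x p y1 q1 y2 q2.
Proof.
move=> Fa Fb Fc Fd Fe Ff.
under eq_tsum => x y do rewrite exchange_tsum.
rewrite (sweedler_coassoc (F := fun u v y => \tsum_(p ⊗ q <- D l)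
  \tsum_(p1 ⊗ p2 <- D p) F u p1 v p2 y q)); try lin.
apply: eq_tsum => x y; rewrite [RHS]exchange_tsum.
apply: eq_tsum => y1 y2.
by rewrite (sweedler_coassoc (F := fun p1 p2 q => F x p1 y1 p2 y2 q)); try lin.
Qed.

(** Coassociativity of the tensor product coalgebra H ⊗ H ⊗ H. *)
Lemma sweedler_coassoc3 (U : lmodType k)
    (F : H -> H -> H -> H -> H -> H -> H -> H -> H -> U) h l m :
    (forall b c d e f p q r, linear (fun a => F a b c d e f p q r)) ->
    (forall a c d e f p q r, linear (fun b => F a b c d e f p q r)) ->
    (forall a b d e f p q r, linear (fun c => F a b c d e f p q r)) ->
    (forall a b c e f p q r, linear (fun d => F a b c d e f p q r)) ->
    (forall a b c d f p q r, linear (fun e => F a b c d e f p q r)) ->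
    (forall a b c d e p q r, linear (fun f => F a b c d e f p q r)) ->
    (forall a b c d e f q r, linear (fun p => F a b c d e f p q r)) ->
    (forall a b c d e f p r, linear (fun q => F a b c d e f p q r)) ->
    (forall a b c d e f p q, linear (fun r => F a b c d e f p q r)) ->
  \tsum_(x ⊗ y <- D h) \tsum_(p ⊗ q <- D l) \tsum_(r ⊗ s <- D m)
    \tsum_(x1 ⊗ x2 <- D x) \tsum_(p1 ⊗ p2 <- D p) \tsum_(r1 ⊗ r2 <- D r)
      F x1 p1 r1 x2 p2 r2 y q s =
  \tsum_(x ⊗ y <- D h) \tsum_(p ⊗ q <- D l) \tsum_(r ⊗ s <- D m)
    \tsum_(y1 ⊗ y2 <- D y) \tsum_(q1 ⊗ q2 <- D q) \tsum_(s1 ⊗ s2 <- D s)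
      F x p r y1 q1 s1 y2 q2 s2.
Proof.
move=> F1 F2 F3 F4 F5 F6 F7 F8 F9.
under eq_tsum => x y do under eq_tsum => p q do rewrite exchange_tsum.
under eq_tsum => x y do rewrite exchange_tsum.
rewrite (sweedler_coassoc (F := fun x1 x2 y => \tsum_(p ⊗ q <- D l)
  \tsum_(r ⊗ s <- D m) \tsum_(p1 ⊗ p2 <- D p) \tsum_(r1 ⊗ r2 <- D r)
  F x1 p1 r1 x2 p2 r2 y q s)); try lin.
apply: eq_tsum => x y.
under [RHS]eq_tsum => p q do rewrite exchange_tsum.
rewrite [RHS]exchange_tsum; apply: eq_tsum => y1 y2.
by rewrite (sweedler_coassoc2
  (F := fun p1 r1 p2 r2 q s => F x p1 r1 y1 p2 r2 y2 q s)); try lin.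
Qed.

End SweedlerCalculus.

(** * The classical crossed product *)

Section CrossedProduct.
Variables (k : fieldType) (H A : lmodType k).
Variables (mH : {linear (H ⊗ H)%type -> H}) (oneH : H).
Variables (D : {linear H -> (H ⊗ H)%type}) (e : {scalar H}).
Hypothesis Hb : bialgebra mH oneH D e.
Variables (mA : {linear (A ⊗ A)%type -> A}) (oneA : A).
Hypothesis Aa : assoc_algebra mA oneA.
Variables (act : {linear (H ⊗ A)%type -> A}) (tau : {linear (H ⊗ H)%type -> A}).

Local Notation "h ∗ l" := (mH (h ⊠ l)) (at level 39, left associativity).
Local Notation "a ⋆ b" := (mA (a ⊠ b)) (at level 39, left associativity).
Local Notation "h ▹ a" := (act (h ⊠ a)) (at level 38, right associativity).
Local Notation τ h l := (tau (h ⊠ l)).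

Hypothesis act1 : forall h, h ▹ oneA = e h *: oneA.
Hypothesis actM : forall h a b,
  h ▹ (a ⋆ b) = \tsum_(h1 ⊗ h2 <- D h) (h1 ▹ a) ⋆ (h2 ▹ b).

Definition twisted_eq := forall h l a,
  \tsum_(h1 ⊗ h2 <- D h) \tsum_(l1 ⊗ l2 <- D l) (h1 ▹ l1 ▹ a) ⋆ τ h2 l2 =
  \tsum_(h1 ⊗ h2 <- D h) \tsum_(l1 ⊗ l2 <- D l) τ h1 l1 ⋆ ((h2 ∗ l2) ▹ a).

Definition cocycle_eq := forall h l m,
  \tsum_(h1 ⊗ h2 <- D h) \tsum_(l1 ⊗ l2 <- D l) \tsum_(m1 ⊗ m2 <- D m)
    (h1 ▹ τ l1 m1) ⋆ τ h2 (l2 ∗ m2) =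
  \tsum_(h1 ⊗ h2 <- D h) \tsum_(l1 ⊗ l2 <- D l) τ h1 l1 ⋆ τ (h2 ∗ l2) m.

Lemma act_mul3 (U : lmodType k) (F : A -> H -> U) h x y z :
    (forall g, linear (fun a => F a g)) -> (forall a, linear (F a)) ->
  \tsum_(g ⊗ g' <- D h) F (g ▹ (x ⋆ y ⋆ z)) g' =
  \tsum_(h1 ⊗ h' <- D h) \tsum_(h2 ⊗ h'' <- D h') \tsum_(h3 ⊗ h4 <- D h'')
    F ((h1 ▹ x) ⋆ (h2 ▹ y) ⋆ (h3 ▹ z)) h4.
Proof.
move=> F1 F2.
under eq_tsum => g g'.
  rewrite actM (linear_tsumE (g := fun a => F a g')) //.
  under eq_tsum => g1 g2.
    rewrite actM tsum_pure_l linear_tsum (linear_tsumE (g := fun a => F a g')) //.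
    over.
  over.
rewrite (sweedler_coassoc Hb (F := fun g1 g2 g' => \tsum_(h1 ⊗ h2 <- D g1)
  F ((h1 ▹ x) ⋆ (h2 ▹ y) ⋆ (g2 ▹ z)) g')); try lin.
under eq_tsum => g1 g' do rewrite exchange_tsum.
by rewrite (sweedler_coassoc Hb (F := fun h1 h2 g' => \tsum_(h3 ⊗ h4 <- D g')
  F ((h1 ▹ x) ⋆ (h2 ▹ y) ⋆ (h3 ▹ z)) h4)); try lin.
Qed.

(** The twisted module identity holds inside longer sums: its two sides are
    convolution products of maps on H ⊗ H, so coassociativity isolates them
    from the remaining legs h3, l3. *)
Lemma twisted_tail (U : lmodType k) (F : A -> H -> H -> U) h l c :
    (forall x y, linear (fun a => F a x y)) ->
    (forall a y, linear (fun x => F a x y)) -> (forall a x, linear (F a x)) ->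
  twisted_eq ->
  \tsum_(h1 ⊗ h' <- D h) \tsum_(l1 ⊗ l' <- D l)
  \tsum_(h2 ⊗ h3 <- D h') \tsum_(l2 ⊗ l3 <- D l')
    F (τ h1 l1 ⋆ ((h2 ∗ l2) ▹ c)) h3 l3 =
  \tsum_(h1 ⊗ h' <- D h) \tsum_(l1 ⊗ l' <- D l)
  \tsum_(h2 ⊗ h3 <- D h') \tsum_(l2 ⊗ l3 <- D l')
    F ((h1 ▹ l1 ▹ c) ⋆ τ h2 l2) h3 l3.
Proof.
move=> F1 F2 F3 tw.
rewrite -(sweedler_coassoc2 Hb (F := fun h1 l1 h2 l2 h3 l3 =>
  F (τ h1 l1 ⋆ ((h2 ∗ l2) ▹ c)) h3 l3)); try lin.
rewrite -(sweedler_coassoc2 Hb (F := fun h1 l1 h2 l2 h3 l3 =>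
  F ((h1 ▹ l1 ▹ c) ⋆ τ h2 l2) h3 l3)); try lin.
apply: eq_tsum => x h3; apply: eq_tsum => y l3.
have /(congr1 (fun a => F a h3 l3)) := tw x y c.
by rewrite !(linear_tsumE2 (g := fun a => F a h3 l3)) // => ->.
Qed.

(** The analogue of twisted_tail for the cocycle identity.  The remaining legs
    enter through their product because m is split on the two sides of the
    identity in different ways, and only the triple product of the last legs
    is common to both, by associativity in H. *)
Lemma cocycle_tail (U : lmodType k) (F : A -> H -> U) h l m :
    (forall x, linear (fun a => F a x)) -> (forall a, linear (F a)) ->
  cocycle_eq ->
  \tsum_(h1 ⊗ h' <- D h) \tsum_(l1 ⊗ l' <- D l)
  \tsum_(h2 ⊗ h3 <- D h') \tsum_(l2 ⊗ l3 <- D l') \tsum_(m1 ⊗ m2 <- D m)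
    F (τ h1 l1 ⋆ τ (h2 ∗ l2) m1) (h3 ∗ l3 ∗ m2) =
  \tsum_(h1 ⊗ h' <- D h) \tsum_(l1 ⊗ l' <- D l) \tsum_(m1 ⊗ m' <- D m)
  \tsum_(h2 ⊗ h3 <- D h') \tsum_(l2 ⊗ l3 <- D l') \tsum_(m2 ⊗ m3 <- D m')
    F ((h1 ▹ τ l1 m1) ⋆ τ h2 (l2 ∗ m2)) (h3 ∗ (l3 ∗ m3)).
Proof.
move=> F1 F2 cocE; have aH := bialg_algebra Hb.
rewrite -(sweedler_coassoc2 Hb (F := fun h1 l1 h2 l2 h3 l3 =>
  \tsum_(m1 ⊗ m2 <- D m) F (τ h1 l1 ⋆ τ (h2 ∗ l2) m1) (h3 ∗ l3 ∗ m2))); try lin.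
rewrite -(sweedler_coassoc3 Hb (F := fun h1 l1 m1 h2 l2 m2 h3 l3 m3 =>
  F ((h1 ▹ τ l1 m1) ⋆ τ h2 (l2 ∗ m2)) (h3 ∗ (l3 ∗ m3)))); try lin.
apply: eq_tsum => x h3; apply: eq_tsum => y l3.
under eq_tsum => h1 h2 do rewrite exchange_tsum.
rewrite exchange_tsum; apply: eq_tsum => z m3.
have /(congr1 (fun a => F a (h3 ∗ (l3 ∗ m3)))) := cocE x y z.
rewrite (linear_tsumE3 (g := fun a => F a (h3 ∗ (l3 ∗ m3)))) //.
rewrite (linear_tsumE2 (g := fun a => F a (h3 ∗ (l3 ∗ m3)))) // => ->.
by rewrite (assoc_mulA aH).
Qed.

Variable M : {linear ((A ⊗ H) ⊗ (A ⊗ H))%type -> (A ⊗ H)%type}.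
Hypothesis ME : forall a h b l, M ((a ⊠ h) ⊠ (b ⊠ l)) =
  \tsum_(h1 ⊗ h' <- D h) \tsum_(h2 ⊗ h3 <- D h') \tsum_(l1 ⊗ l2 <- D l)
    ((a ⋆ (h1 ▹ b) ⋆ τ h2 l1) ⊠ (h3 ∗ l2)).

Lemma crossed_mulAl a h b l c m :
  M (M ((a ⊠ h) ⊠ (b ⊠ l)) ⊠ (c ⊠ m)) =
  \tsum_(h1 ⊗ h' <- D h) \tsum_(h2 ⊗ h'' <- D h') \tsum_(l1 ⊗ l' <- D l)
  \tsum_(h3 ⊗ hc <- D h'') \tsum_(l2 ⊗ l'' <- D l')
  \tsum_(h4 ⊗ h5 <- D hc) \tsum_(l3 ⊗ l4 <- D l'') \tsum_(m1 ⊗ m2 <- D m)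
    ((a ⋆ (h1 ▹ b) ⋆ (τ h2 l1 ⋆ ((h3 ∗ l2) ▹ c)) ⋆ τ (h4 ∗ l3) m1)
     ⊠ (h5 ∗ l4 ∗ m2)).
Proof.
rewrite ME tsum_pure_l linear_tsum; apply: eq_tsum => h1 h'.
rewrite tsum_pure_l linear_tsum; apply: eq_tsum => h2 h''.
rewrite tsum_pure_l linear_tsum; apply: eq_tsum => l1 l'.
rewrite ME (sweedler_comulM Hb); try lin.
apply: eq_tsum => h3 hc; apply: eq_tsum => l2 l''.
rewrite (sweedler_comulM Hb); try lin.
by do 3![apply: eq_tsum => ? ?]; rewrite !(assoc_mulA Aa).
Qed.

(** The summation order is chosen so that it agrees with crossed_mulAl up to
    where the twisted module identity and the cocycle identity are applied. *)
Lemma crossed_mulAr a h b l c m :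
  M ((a ⊠ h) ⊠ M ((b ⊠ l) ⊠ (c ⊠ m))) =
  \tsum_(h1 ⊗ h' <- D h) \tsum_(h2 ⊗ h'' <- D h') \tsum_(l1 ⊗ l' <- D l)
  \tsum_(h3 ⊗ hc <- D h'') \tsum_(l2 ⊗ l'' <- D l') \tsum_(m1 ⊗ m' <- D m)
  \tsum_(h4 ⊗ h5 <- D hc) \tsum_(l3 ⊗ l4 <- D l'') \tsum_(m2 ⊗ m3 <- D m')
    ((a ⋆ (h1 ▹ b) ⋆ (h2 ▹ l1 ▹ c)
       ⋆ ((h3 ▹ τ l2 m1) ⋆ τ h4 (l3 ∗ m2))) ⊠ (h5 ∗ (l4 ∗ m3))).
Proof.
(* Expansion sums over the legs of l and m first; the sums over the legs of h
   are moved outwards afterwards. *)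
transitivity (\tsum_(l1 ⊗ l' <- D l) \tsum_(l2 ⊗ l'' <- D l')
  \tsum_(m1 ⊗ m' <- D m) \tsum_(h1 ⊗ h' <- D h) \tsum_(h2 ⊗ h'' <- D h')
  \tsum_(h3 ⊗ hc <- D h'')
  \tsum_(h4 ⊗ h5 <- D hc) \tsum_(l3 ⊗ l4 <- D l'') \tsum_(m2 ⊗ m3 <- D m')
    ((a ⋆ (h1 ▹ b) ⋆ (h2 ▹ l1 ▹ c)
       ⋆ ((h3 ▹ τ l2 m1) ⋆ τ h4 (l3 ∗ m2))) ⊠ (h5 ∗ (l4 ∗ m3)))).
  rewrite ME tsum_pure_r linear_tsum; apply: eq_tsum => l1 l'.
  rewrite tsum_pure_r linear_tsum; apply: eq_tsum => l2 l''.
  rewrite tsum_pure_r linear_tsum; apply: eq_tsum => m1 m'.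
  rewrite ME (act_mul3 (F := fun z y => \tsum_(h4 ⊗ h5 <- D y)
    \tsum_(u ⊗ v <- D (l'' ∗ m')) ((a ⋆ z ⋆ τ h4 u) ⊠ (h5 ∗ v)))); try lin.
  do 4![apply: eq_tsum => ? ?]; rewrite (sweedler_comulM Hb); try lin.
  by do 2![apply: eq_tsum => ? ?]; rewrite !(assoc_mulA Aa).
under eq_tsum => ? ? do under eq_tsum => ? ? do rewrite exchange_tsum.
under eq_tsum => ? ? do rewrite exchange_tsum.
rewrite exchange_tsum; apply: eq_tsum => h1 h'.
under eq_tsum => ? ? do under eq_tsum => ? ? do rewrite exchange_tsum.
under eq_tsum => ? ? do rewrite exchange_tsum.
rewrite exchange_tsum; apply: eq_tsum => h2 h''.
apply: eq_tsum => l1 l'.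
under eq_tsum => ? ? do rewrite exchange_tsum.
by rewrite exchange_tsum.
Qed.

(** Reading the left bracketing, the module identity moves τ to the right of the
    action on c; there it meets the other value of τ, and the cocycle identity
    applies to the two of them. *)
Lemma crossed_mulA_pure : twisted_eq -> cocycle_eq -> forall a h b l c m,
  M ((a ⊠ h) ⊠ M ((b ⊠ l) ⊠ (c ⊠ m))) = M (M ((a ⊠ h) ⊠ (b ⊠ l)) ⊠ (c ⊠ m)).
Proof.
move=> tw cocE a h b l c m; rewrite crossed_mulAl crossed_mulAr.
apply: eq_tsum => h1 h'; symmetry.
rewrite (twisted_tail (F := fun z x y => \tsum_(h4 ⊗ h5 <- D x)
  \tsum_(l3 ⊗ l4 <- D y) \tsum_(m1 ⊗ m2 <- D m)
  ((a ⋆ (h1 ▹ b) ⋆ z ⋆ τ (h4 ∗ l3) m1) ⊠ (h5 ∗ l4 ∗ m2)))) //; try lin.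
apply: eq_tsum => h2 h''; apply: eq_tsum => l1 l'.
rewrite -(cocycle_tail (F := fun z x =>
  (a ⋆ (h1 ▹ b) ⋆ (h2 ▹ l1 ▹ c) ⋆ z) ⊠ x)) //; try lin.
by do 5![apply: eq_tsum => ? ?]; rewrite !(assoc_mulA Aa).
Qed.

Lemma crossed_mul1l a h :
  M ((oneA ⊠ oneH) ⊠ (a ⊠ h)) =
  \tsum_(h1 ⊗ h2 <- D h) (((oneH ▹ a) ⋆ τ oneH h1) ⊠ h2).
Proof.
have aH := bialg_algebra Hb.
rewrite ME (sweedler_comul1 Hb); try lin.
rewrite (sweedler_comul1 Hb); try lin.
by apply: eq_tsum => x y; rewrite (assoc_mul1l Aa) (assoc_mul1l aH).
Qed.

Lemma crossed_mul1r a h :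
  M ((a ⊠ h) ⊠ (oneA ⊠ oneH)) =
  \tsum_(h1 ⊗ h2 <- D h) ((a ⋆ τ h1 oneH) ⊠ h2).
Proof.
have aH := bialg_algebra Hb; rewrite ME.
under eq_tsum => h1 h'.
  under eq_tsum => h2 h3.
    rewrite (sweedler_comul1 Hb); try lin.
    rewrite act1 pure_scaler linearZ pure_scalel linearZ pure_scalel.
    rewrite (assoc_mul1r Aa) (assoc_mul1r aH); over.
  rewrite -(linear_tsumE (g := fun u => e h1 *: u)); try lin.
  over.
by rewrite (sweedler_counitl Hb (F := fun h' => \tsum_(h2 ⊗ h3 <- D h')
  ((a ⋆ τ h2 oneH) ⊠ h3))); try lin.
Qed.

(** The map id ⊗ ε recovers identities in A from identities in A # H. *)
Fact proj_is_linear : linear (fun t : A ⊗ H => \tsum_(a ⊗ h <- t) (e h *: a)).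
Proof. by lin. Qed.

Definition proj : {linear (A ⊗ H)%type -> A} :=
  HB.pack (fun t : A ⊗ H => \tsum_(a ⊗ h <- t) (e h *: a))
    (GRing.isLinear.Build _ _ _ _ _ proj_is_linear).

Lemma proj_pure a h : proj (a ⊠ h) = e h *: a.
Proof. by rewrite /= tsum_pure //; lin. Qed.

Lemma proj_crossed_mul a h b l :
  proj (M ((a ⊠ h) ⊠ (b ⊠ l))) =
  \tsum_(h1 ⊗ h2 <- D h) a ⋆ (h1 ▹ b) ⋆ τ h2 l.
Proof.
rewrite ME linear_tsum; apply: eq_tsum => h1 h'.
rewrite linear_tsum.
under eq_tsum => h2 h3.
  rewrite linear_tsum.
  under eq_tsum => l1 l2 do
    rewrite proj_pure (bialg_counitM Hb) -scalerA.
  rewrite -(linear_tsumE (g := fun u => e h3 *: u)); try lin.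
  rewrite (sweedler_counitr Hb (F := fun l => a ⋆ (h1 ▹ b) ⋆ τ h2 l)); try lin.
  over.
by rewrite (sweedler_counitr Hb (F := fun h => a ⋆ (h1 ▹ b) ⋆ τ h l)); try lin.
Qed.

Lemma proj_crossed_mul1 h l :
  proj (M ((oneA ⊠ h) ⊠ (oneA ⊠ l))) = τ h l.
Proof.
rewrite proj_crossed_mul.
under eq_tsum => x y.
  rewrite act1 (assoc_mul1l Aa) pure_scalel linearZ (assoc_mul1l Aa).
  over.
by rewrite (sweedler_counitl Hb (F := fun y => τ y l)); try lin.
Qed.

(** The product of A # H is built from operations that f and g preserve, and
    from τ; and τ is itself recovered from the product by id ⊗ ε, through
    (1 # h)(1 # l). *)
Lemma crossed_endoP (f : {linear A -> A}) (g : {linear H -> H}) :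
    (forall a b, f (a ⋆ b) = f a ⋆ f b) -> f oneA = oneA ->
    (forall h l, g (h ∗ l) = g h ∗ g l) ->
    (forall h, D (g h) = tensor_map g g (D h)) ->
    (forall h, e (g h) = e h) ->
    (forall h a, f (h ▹ a) = g h ▹ f a) ->
  (forall x y, tensor_map f g (M (x ⊠ y)) =
               M (tensor_map f g x ⊠ tensor_map f g y)) <->
  (forall h l, f (τ h l) = τ (g h) (g l)).
Proof.
move=> fM f1 gM gD ge fact; split=> [tM h l|ftau x y].
  have projE t : f (proj t) = proj (tensor_map f g t).
    apply: (pure_ext (f := fun t => f (proj t))
      (g := fun t => proj (tensor_map f g t))); try lin.
    by move=> a {}h; rewrite tensor_map_pure !proj_pure linearZ ge.
  rewrite -[in LHS]proj_crossed_mul1 projE tM !tensor_map_pure f1.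
  exact: proj_crossed_mul1.
apply: (pure_ext (f := fun x => tensor_map f g (M (x ⊠ y)))
  (g := fun x => M (tensor_map f g x ⊠ _))); try lin; move=> a h {x}.
apply: (pure_ext (f := fun y => tensor_map f g (M (_ ⊠ y)))
  (g := fun y => M (_ ⊠ tensor_map f g y))); try lin; move=> b l {y}.
rewrite !tensor_map_pure !ME (gD h) tsum_tensor_map; try lin.
rewrite (linear_tsum (tensor_map f g)); apply: eq_tsum => h1 h'.
rewrite (gD h') tsum_tensor_map; try lin.
rewrite (linear_tsum (tensor_map f g)); apply: eq_tsum => h2 h3.
rewrite gD tsum_tensor_map; try lin.
rewrite (linear_tsum (tensor_map f g)); apply: eq_tsum => l1 l2 /=.
by rewrite tensor_map_pure !fM gM ftau fact.
Qed.

(** The converse applies id ⊗ ε to the unit laws, then to associativity of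
    (1 # h)(1 # l)(a # 1) for the module identity and of (1 # h)(1 # l)(1 # m)
    for the cocycle identity. *)
Theorem crossed_product_assocP :
  assoc_algebra M (oneA ⊠ oneH) <->
  [/\ (forall a, oneH ▹ a = a) /\ twisted_eq,
      forall h, τ oneH h = e h *: oneA /\ τ h oneH = e h *: oneA
    & cocycle_eq].
Proof.
split=> [Ma|[[a1 tw] tau1 cocE]]; last first.
  split.
  - move=> x y z.
    apply: (pure_ext (f := fun x => M (x ⊠ M (y ⊠ z)))
      (g := fun x => M (M (x ⊠ y) ⊠ z)) _ _ _ x); try lin; move=> a h {x}.
    apply: (pure_ext (f := fun y => M ((a ⊠ h) ⊠ M (y ⊠ z)))
      (g := fun y => M (M ((a ⊠ h) ⊠ y) ⊠ z)) _ _ _ y); try lin; move=> b l {y}.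
    apply: (pure_ext (f := fun z => M ((a ⊠ h) ⊠ M ((b ⊠ l) ⊠ z)))
      (g := fun z => M (M ((a ⊠ h) ⊠ (b ⊠ l)) ⊠ z)) _ _ _ z); try lin.
    by move=> c m; apply: crossed_mulA_pure.
  - apply: (pure_ext (f := fun x => M (_ ⊠ x)) (g := id)); try lin; move=> a h /=.
    rewrite crossed_mul1l a1.
    under eq_tsum => x y do
      rewrite (tau1 x).1 pure_scaler linearZ pure_scalel (assoc_mul1r Aa).
    by rewrite (sweedler_counitl Hb (F := fun y => a ⊠ y)); try lin.
  - apply: (pure_ext (f := fun x => M (x ⊠ _)) (g := id)); try lin; move=> a h /=.
    rewrite crossed_mul1r.
    under eq_tsum => x y do
      rewrite (tau1 x).2 pure_scaler linearZ pure_scalel (assoc_mul1r Aa).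
    by rewrite (sweedler_counitl Hb (F := fun y => a ⊠ y)); try lin.
have aH := bialg_algebra Hb.
have tau1l h : τ oneH h = e h *: oneA.
  by rewrite -proj_crossed_mul1 (assoc_mul1l Ma) proj_pure.
have act1l a : oneH ▹ a = a.
  have /(congr1 proj) := assoc_mul1l Ma (a ⊠ oneH).
  rewrite proj_crossed_mul proj_pure (sweedler_comul1 Hb); try lin.
  rewrite tau1l (assoc_mul1l Aa) (bialg_counit1 Hb) !scale1r.
  by rewrite (assoc_mul1r Aa).
have tau1r h : τ h oneH = e h *: oneA.
  by rewrite -proj_crossed_mul1 (assoc_mul1r Ma) proj_pure.
have mul1a h b : M ((oneA ⊠ h) ⊠ (b ⊠ oneH)) =
    \tsum_(h1 ⊗ h2 <- D h) ((h1 ▹ b) ⊠ h2).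
  rewrite ME; apply: eq_tsum => h1 h'.
  under eq_tsum => h2 h3.
    rewrite (sweedler_comul1 Hb); try lin.
    rewrite tau1r pure_scaler linearZ pure_scalel (assoc_mul1r Aa).
    rewrite (assoc_mul1l Aa) (assoc_mul1r aH); over.
  by rewrite (sweedler_counitl Hb (F := fun y => (h1 ▹ b) ⊠ y)); try lin.
have mul11 h l : M ((oneA ⊠ h) ⊠ (oneA ⊠ l)) =
    \tsum_(h1 ⊗ h2 <- D h) \tsum_(l1 ⊗ l2 <- D l) (τ h1 l1 ⊠ (h2 ∗ l2)).
  rewrite ME.
  under eq_tsum => h1 h'.
    under eq_tsum => h2 h3.
      under eq_tsum => l1 l2 do
        rewrite act1 (assoc_mul1l Aa) pure_scalel linearZ pure_scalel
          (assoc_mul1l Aa).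
      rewrite -(linear_tsumE (g := fun u => e h1 *: u)); try lin.
      over.
    rewrite -(linear_tsumE (g := fun u => e h1 *: u)); try lin.
    over.
  by rewrite (sweedler_counitl Hb (F := fun h' => \tsum_(h2 ⊗ h3 <- D h')
    \tsum_(l1 ⊗ l2 <- D l) (τ h2 l1 ⊠ (h3 ∗ l2)))); try lin.
split=> [|//|]; first split=> //.
- move=> h l a.
  have /(congr1 proj) := assoc_mulA Ma (oneA ⊠ h) (oneA ⊠ l) (a ⊠ oneH).
  rewrite mul1a mul11 !tsum_pure_r !tsum_pure_l !linear_tsum => E.
  etransitivity; last etransitivity; [|exact: E|].
    rewrite exchange_tsum; apply: eq_tsum => l1 l2.
    rewrite proj_crossed_mul; apply: eq_tsum => h1 h2.
    by rewrite (assoc_mul1l Aa).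
  apply: eq_tsum => h1 h2; rewrite tsum_pure_l !linear_tsum; apply: eq_tsum => l1 l2.
  rewrite proj_crossed_mul.
  under eq_tsum => x y do
    rewrite tau1r pure_scaler linearZ (assoc_mul1r Aa).
  by rewrite (sweedler_counitr Hb (F := fun x => τ h1 l1 ⋆ (x ▹ a))); try lin.
- move=> h l m.
  have /(congr1 proj) := assoc_mulA Ma (oneA ⊠ h) (oneA ⊠ l) (oneA ⊠ m).
  rewrite !mul11 !tsum_pure_r !tsum_pure_l !linear_tsum => E.
  etransitivity; last etransitivity; [|exact: E|].
    rewrite exchange_tsum; apply: eq_tsum => l1 l2.
    rewrite tsum_pure_r !linear_tsum exchange_tsum; apply: eq_tsum => m1 m2.
    rewrite proj_crossed_mul; apply: eq_tsum => h1 h2.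
    by rewrite (assoc_mul1l Aa).
  apply: eq_tsum => h1 h2; rewrite tsum_pure_l !linear_tsum; apply: eq_tsum => l1 l2.
  rewrite proj_crossed_mul.
  under eq_tsum => x y do
    rewrite act1 pure_scaler linearZ (assoc_mul1r Aa) pure_scalel linearZ.
  by rewrite (sweedler_counitl Hb (F := fun y => τ h1 l1 ⋆ τ y m)); try lin.
Qed.

End CrossedProduct.

(** * Removing the Hom-twist *)

Definition untwist (k : fieldType) (V : lmodType k) (f : linear_automorphism V)
    (mul : {linear (V ⊗ V)%type -> V}) : {linear (V ⊗ V)%type -> V} :=
  f^{-1} \o mul.

Lemma autVM (k : fieldType) (V : lmodType k) (f : linear_automorphism V)
    (mul : {linear (V ⊗ V)%type -> V}) :
  (forall a b, f (mul (a ⊠ b)) = mul (f a ⊠ f b)) ->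
  forall a b, f^{-1} (mul (a ⊠ b)) = mul (f^{-1} a ⊠ f^{-1} b).
Proof.
by move=> fM a b; apply: (can_inj (autK f)); rewrite fM !autVK.
Qed.

(** Hom-associativity f(a)(bc) = (ab)f(c) becomes f^2 applied to associativity
    of the product f^-1(ab), and a1 = f(a) = 1a becomes the unit laws. *)
Lemma untwist_algebraP (k : fieldType) (V : lmodType k)
    (f : linear_automorphism V) (mul : {linear (V ⊗ V)%type -> V}) (one : V) :
  hom_algebra f mul one <->
  [/\ assoc_algebra (untwist f mul) one,
      forall a b, f (untwist f mul (a ⊠ b)) = untwist f mul (f a ⊠ f b)
    & f one = one].
Proof.
split.
  case; rewrite tensE => mulA mul1r mul1l fM f1.
  split=> //; first split=> /=.
  - move=> a b c; apply: (can_inj (autK f)); apply: (can_inj (autK f)).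
    by rewrite !autVK fM autVK mulA fM !autVK.
  - by move=> a; rewrite mul1l autK.
  - by move=> a; rewrite mul1r autK.
  by move=> a b /=; rewrite autVK -fM autK.
case=> [[/= mulA mul1l mul1r] fM f1].
have fM' a b : f (mul (a ⊠ b)) = mul (f a ⊠ f b).
  by have := fM a b => /= /(congr1 f); rewrite !autVK.
split=> //; rewrite tensE //.
- move=> a b c; have := mulA a b c.
  by do 2 move=> /(congr1 f); rewrite !autVK !fM' !autVK.
- by move=> a; have := congr1 f (mul1r a); rewrite autVK.
- by move=> a; have := congr1 f (mul1l a); rewrite autVK.
Qed.

Section HopfUntwisting.
Variables (k : fieldType) (H : monoidalHomHopfType k).
Local Notation α := (hom_aut H).

Definition hopf_untwisted_comul : {linear H -> (H ⊗ H)%type} :=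
  tensor_map α α \o Δ.

Local Notation D := hopf_untwisted_comul.
Local Notation e := (@hopf_counit k H).
Local Notation "h ∗ l" := (untwist α hom_mul (h ⊠ l))
  (at level 39, left associativity).

Lemma tsum_comul (U : lmodType k) (F : H -> H -> U) h :
    (forall y, linear (fun x => F x y)) -> (forall x, linear (F x)) ->
  \tsum_(x ⊗ y <- D h) F x y = \tsum_(x ⊗ y <- Δ h) F (α x) (α y).
Proof. by move=> F1 F2; rewrite tsum_tensor_map. Qed.

Lemma hopf_comul_aut h : Δ (α h) = D h.
Proof.
rewrite (hom_comul_aut (hopf_coalgebraP H)).
by rewrite -[RHS]/(tensor_map α α (Δ h)) /tensor_map tensE sweedlerE.
Qed.

Lemma comul_aut h : D (α h) = tensor_map α α (D h).
Proof. by congr (tensor_map _ _ _); rewrite hopf_comul_aut. Qed.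

Lemma counit_autV h : e (α^{-1} h) = e h.
Proof. by rewrite -[in RHS](autVK α h) (hom_counit_aut (hopf_coalgebraP H)). Qed.

Lemma aut_mulH g h : α (g ∗ h) = α g ∗ α h.
Proof. by have /untwist_algebraP[_ -> _] := hom_algebraP H. Qed.

(** Hom-coassociativity yields coassociativity after applying α^2 to all three
    legs.  The comultiplication is multiplicative because it sends α^-1(gh) to
    Δ(gh), so that the twists of product and coproduct cancel. *)
Theorem hopf_bialgebra : bialgebra (untwist α hom_mul) (hom_one H) D e.
Proof.
have /untwist_algebraP[Ha αM α1] := hom_algebraP H.
have [coA cor col coaut caut] := hopf_coalgebraP H.
rewrite tensE sweedlerE in coA, cor, col.
have := @hopf_comulM _ H; rewrite tensE sweedlerE => coM.
split; first exact: Ha.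
- move=> h; rewrite !tsum_comul; try lin.
  have /(congr1 (tensor_map (α \o α) (tensor_map (α \o α) (α \o α)))) := coA h.
  rewrite !linear_tsum => E.
  etransitivity; last etransitivity; [|exact: esym E|]; apply: eq_tsum => x y.
    rewrite comul_aut tsum_tensor_map ?tsum_comul ?linear_tsum; try lin.
    by apply: eq_tsum => u v; do 2![rewrite /= tensor_map_pure]; rewrite /= autVK.
  rewrite comul_aut tsum_tensor_map ?tsum_comul ?linear_tsum; try lin.
  by apply: eq_tsum => u v; do 2![rewrite /= tensor_map_pure]; rewrite /= autVK.
- move=> h; rewrite tsum_comul; try lin.
  rewrite -[RHS](autVK α) -cor linear_tsum; apply: eq_tsum => x y.
  by rewrite caut linearZ.
- move=> h; rewrite tsum_comul; try lin.
  rewrite -[RHS](autVK α) -col linear_tsum; apply: eq_tsum => x y.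
  by rewrite caut linearZ.
- move=> g h; rewrite [LHS]/= -[X in tensor_map _ _ X]/(Δ (g ∗ h)).
  have -> : tensor_map α α (Δ (g ∗ h)) = Δ (hom_mul (g ⊠ h)).
    rewrite -[in RHS](autVK α (hom_mul _)) coaut /tensor_map tensE sweedlerE //.
  rewrite coM tsum_comul; try lin.
  apply: eq_tsum => x y; rewrite tsum_comul; try lin.
  by apply: eq_tsum => u v; rewrite -!αM /= !autVK.
- by rewrite /= hopf_comul1 tensE tensor_map_pure α1.
- by move=> g h; rewrite /= counit_autV -hopf_counitM tensE.
- exact: hopf_counit1.
Qed.

End HopfUntwisting.

Section Untwisting.
Variables (k : fieldType) (H : monoidalHomHopfType k) (A : homAlgType k).
Variables (act : {linear (H ⊗ A)%type -> A}).
Variables (sigma : {linear (H ⊗ H)%type -> A}).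
Hypothesis act_weak : weak_action act.

Local Notation α := (hom_aut H).
Local Notation β := (hom_aut A).
Local Notation mulH := (untwist α hom_mul).
Local Notation mulA := (untwist β hom_mul).
Local Notation D := (hopf_untwisted_comul H).
Local Notation "a • b" := (hom_mul (a ⊠ b)) (at level 39, left associativity).
Local Notation "a ⋆ b" := (mulA (a ⊠ b)) (at level 39, left associativity).
Local Notation "h ∗ l" := (mulH (h ⊠ l)) (at level 39, left associativity).

Definition untwisted_act : {linear (H ⊗ A)%type -> A} := β^{-1} \o act.

(** The inner α^-2 absorbs the powers of α that the untwisted comultiplication
    puts on the legs of h and l in the multiplication of A #_σ H, and the outer
    β those that rebracketing a(xy) puts on the last factor. *)
Definition untwisted_cocycle : {linear (H ⊗ H)%type -> A} :=
  (β \o sigma) \o tensor_map (α^{-1} \o α^{-1}) (α^{-1} \o α^{-1}).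

Local Notation "h ▹ a" := (untwisted_act (h ⊠ a))
  (at level 38, right associativity).
Local Notation τ h l := (untwisted_cocycle (h ⊠ l)).
Local Notation M := (untwist (tensor_aut β α) (crossed_mul act sigma)).

Lemma untwisted_cocycleE h l :
  τ h l = β (sigma (α^{-1} (α^{-1} h) ⊠ α^{-1} (α^{-1} l))).
Proof. by rewrite /= tensor_map_pure. Qed.

Lemma act_autE h a : β (act (h ⊠ a)) = act (α h ⊠ β a).
Proof. by have [+ _ _] := act_weak; rewrite tensE => ->. Qed.

Lemma act_autVE h a : β^{-1} (act (h ⊠ a)) = act (α^{-1} h ⊠ β^{-1} a).
Proof. by rewrite -[in LHS](autVK α h) -[in LHS](autVK β a) -act_autE autK. Qed.

Lemma mulA_aut a b : β (a • b) = β a • β b.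
Proof. by have [_ _ _ + _] := hom_algebraP A; rewrite tensE => ->. Qed.

Lemma mulA_assoc a b c : β a • (b • c) = a • b • β c.
Proof. by have [+ _ _ _ _] := hom_algebraP A; rewrite tensE => ->. Qed.

Lemma mulA_autV a b : β^{-1} (a • b) = β^{-1} a • β^{-1} b.
Proof. exact: autVM mulA_aut a b. Qed.

Lemma mulH_aut h l : α (h • l) = α h • α l.
Proof. by have [_ _ _ + _] := hom_algebraP H; rewrite tensE => ->. Qed.

Lemma autV_one : β^{-1} (hom_one A) = hom_one A.
Proof. by rewrite -[in LHS](hom_aut1 (hom_algebraP A)) autK. Qed.

Lemma untwisted_act1 h : h ▹ hom_one A = ε h *: hom_one A.
Proof.
by have [_ + _] := act_weak; rewrite /= tensE => ->; rewrite linearZ /= autV_one.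
Qed.

Lemma untwisted_act_aut h a : β (h ▹ a) = α h ▹ β a.
Proof. by rewrite /= -act_autE autK autVK. Qed.

Lemma untwisted_actM h a b :
  h ▹ (a ⋆ b) = \tsum_(h1 ⊗ h2 <- D h) (h1 ▹ a) ⋆ (h2 ▹ b).
Proof.
have [_ _ +] := act_weak; rewrite tensE sweedlerE => actM.
rewrite /= -[X in β^{-1} X](autK β) act_autE autVK actM.
rewrite hopf_comul_aut !linear_tsum; apply: eq_tsum => h1 h2.
by rewrite mulA_autV.
Qed.

Lemma untwisted_crossed_mulE a h b l : M ((a ⊠ h) ⊠ (b ⊠ l)) =
  \tsum_(h1 ⊗ h' <- D h) \tsum_(h2 ⊗ h3 <- D h') \tsum_(l1 ⊗ l2 <- D l)
    ((a ⋆ (h1 ▹ b) ⋆ τ h2 l1) ⊠ (h3 ∗ l2)).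
Proof.
rewrite [LHS]/= -tensE crossed_mulE /crossed_formula tensE sweedlerE.
rewrite (linear_tsum (tensor_map _ _)) tsum_comul; try lin.
apply: eq_tsum => x y; rewrite (comul_aut y) tsum_tensor_map; try lin.
rewrite (linear_tsum (tensor_map _ _)) tsum_comul; try lin.
apply: eq_tsum => u v; rewrite (linear_tsum (tensor_map _ _)) tsum_comul; try lin.
apply: eq_tsum => p q.
rewrite /= tensor_map_pure /= tensor_map_pure /= !autK.
congr (_ ⊠ _); congr (β^{-1} _).
by rewrite mulA_autV !act_autVE autK -[in LHS](autVK β a) mulA_assoc.
Qed.

(** The equivariance of τ is that of σ evaluated at α^-2 ⊗ α^-2, which is
    bijective. *)
Lemma untwisted_cocycle_autP :
  (forall h l, β (τ h l) = τ (α h) (α l)) <->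
  sigma \o tensor_map α α =1 β \o sigma.
Proof.
split=> [tauE t|sE h l].
  apply: (pure_ext (f := fun t => sigma (tensor_map α α t))
    (g := fun t => β (sigma t))); try lin; move=> h l {t}.
  rewrite tensor_map_pure; apply: (can_inj (autK β)).
  have := tauE (α (α h)) (α (α l)).
  by rewrite !untwisted_cocycleE !autK => ->.
have := sE (α^{-1} (α^{-1} h) ⊠ α^{-1} (α^{-1} l)).
by rewrite !untwisted_cocycleE /= tensor_map_pure !autVK !autK => ->.
Qed.

(** Equivariance of τ gives σ = β ∘ τ, which turns each side of the Hom-identities
    into β^2 of the corresponding side of the ordinary ones. *)
Section EquivariantCocycle.
Hypothesis tau_aut : forall h l, β (τ h l) = τ (α h) (α l).

Lemma cocycleE h l : sigma (h ⊠ l) = β (τ h l).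
Proof.
apply: (can_inj (autK β)); rewrite [in RHS]tau_aut [in RHS]tau_aut.
by rewrite untwisted_cocycleE !autK.
Qed.

Lemma twisted_moduleP : twisted_module act sigma <->
  (forall a, hom_one H ▹ a = a) /\
  twisted_eq mulH D mulA untwisted_act untwisted_cocycle.
Proof.
have oneP : (forall a, act (hom_one H ⊠ a) = β a) <->
    (forall a, hom_one H ▹ a = a).
  by split=> E a; [rewrite /= E autK | rewrite -[in RHS](E a) autVK].
have lhsE h l a : \tsum_(h1 ⊗ h2 <- Δ h) \tsum_(l1 ⊗ l2 <- Δ l)
    (act (α h1 ⊠ act (l1 ⊠ β^{-1} a)) • sigma (α h2 ⊠ α l2)) =
  β (β (\tsum_(h1 ⊗ h2 <- D h) \tsum_(l1 ⊗ l2 <- D l)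
    (h1 ▹ l1 ▹ a) ⋆ τ h2 l2)).
  rewrite tsum_comul; try lin.
  rewrite !(linear_tsum β); apply: eq_tsum => x y.
  rewrite tsum_comul; try lin.
  rewrite !(linear_tsum β); apply: eq_tsum => u v.
  by rewrite cocycleE [in RHS]/= autVK mulA_aut autVK act_autVE autK.
have rhsE h l a : \tsum_(h1 ⊗ h2 <- Δ h) \tsum_(l1 ⊗ l2 <- Δ l)
    (sigma (α h1 ⊠ α l1) • act ((h2 • l2) ⊠ a)) =
  β (β (\tsum_(h1 ⊗ h2 <- D h) \tsum_(l1 ⊗ l2 <- D l)
    τ h1 l1 ⋆ ((h2 ∗ l2) ▹ a))).
  rewrite tsum_comul; try lin.
  rewrite !(linear_tsum β); apply: eq_tsum => x y.
  rewrite tsum_comul; try lin.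
  rewrite !(linear_tsum β); apply: eq_tsum => u v.
  by rewrite cocycleE [in RHS]/= autVK mulA_aut autVK -mulH_aut autK.
rewrite /twisted_module tensE sweedlerE; split=> -[/oneP one1 tw]; split=> //.
  move=> h l a; apply: (can_inj (autK β)); apply: (can_inj (autK β)).
  by rewrite -lhsE -rhsE.
by move=> h l a; rewrite lhsE rhsE tw.
Qed.

Lemma normal_cocycleP : normal_cocycle act sigma <->
  (forall h, τ (hom_one H) h = ε h *: hom_one A /\
             τ h (hom_one H) = ε h *: hom_one A) /\
  cocycle_eq mulH D mulA untwisted_act untwisted_cocycle.
Proof.
have scalarE h l c : sigma (h ⊠ l) = c *: hom_one A <-> τ h l = c *: hom_one A.
  rewrite cocycleE -{1}(hom_aut1 (hom_algebraP A)) -linearZ.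
  by split=> [/(can_inj (autK β))|->].
have lhsE h l m : \tsum_(h1 ⊗ h2 <- Δ h) \tsum_(l1 ⊗ l2 <- Δ l)
  \tsum_(m1 ⊗ m2 <- Δ m)
    (act (α h1 ⊠ sigma (l1 ⊠ m1)) • sigma (α h2 ⊠ (l2 • m2))) =
  β (β (\tsum_(h1 ⊗ h2 <- D h) \tsum_(l1 ⊗ l2 <- D l) \tsum_(m1 ⊗ m2 <- D m)
    (h1 ▹ τ l1 m1) ⋆ τ h2 (l2 ∗ m2))).
  rewrite tsum_comul; try lin.
  rewrite !(linear_tsum β); apply: eq_tsum => x y.
  rewrite tsum_comul; try lin.
  rewrite !(linear_tsum β); apply: eq_tsum => u v.
  rewrite tsum_comul; try lin.
  rewrite !(linear_tsum β); apply: eq_tsum => p q.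
  rewrite !cocycleE -tau_aut [untwist _ _ _ in RHS]/=.
  by rewrite -[in RHS]mulH_aut [in RHS]autK autVK mulA_aut [in RHS]/= autVK.
have rhsE h l m : \tsum_(h1 ⊗ h2 <- Δ h) \tsum_(l1 ⊗ l2 <- Δ l)
    (sigma (α h1 ⊠ α l1) • sigma ((h2 • l2) ⊠ m)) =
  β (β (\tsum_(h1 ⊗ h2 <- D h) \tsum_(l1 ⊗ l2 <- D l)
    τ h1 l1 ⋆ τ (h2 ∗ l2) m)).
  rewrite tsum_comul; try lin.
  rewrite !(linear_tsum β); apply: eq_tsum => x y.
  rewrite tsum_comul; try lin.
  rewrite !(linear_tsum β); apply: eq_tsum => u v.
  rewrite !cocycleE [untwist _ _ _ in RHS]/=.
  by rewrite -[in RHS]mulH_aut [in RHS]autK autVK mulA_aut.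
rewrite /normal_cocycle tensE sweedlerE; split=> -[n1 coc]; split.
- by move=> h; have [/scalarE ? /scalarE ?] := n1 h.
- move=> h l m; apply: (can_inj (autK β)); apply: (can_inj (autK β)).
  by rewrite -lhsE -rhsE.
- by move=> h; have [/scalarE ? /scalarE ?] := n1 h.
by move=> h l m; rewrite lhsE rhsE coc.
Qed.

End EquivariantCocycle.

End Untwisting.

Theorem proposition3p3 (k : fieldType)
    (H : monoidalHomHopfType k) (A : homAlgType k)
    (act : {linear (H ⊗ A)%type -> A}) (sigma : {linear (H ⊗ H)%type -> A})
    (act_weak : weak_action act)
    (sigma_inv : convolution_invertible sigma) :
  hom_algebra (tensor_aut (hom_aut A) (hom_aut H))
    (crossed_mul act sigma) (hom_one A ⊗ hom_one H) <->
  [/\ twisted_module act sigma,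
      normal_cocycle act sigma
    & sigma \o tensor_map (hom_aut H) (hom_aut H) =1 hom_aut A \o sigma].
Proof.
have Hb := hopf_bialgebra H.
have /untwist_algebraP[Aa betaM beta1] := hom_algebraP A.
have act1 := untwisted_act1 act_weak; have actM := untwisted_actM act_weak.
have ME := untwisted_crossed_mulE sigma act_weak.
have assocP := crossed_product_assocP Hb Aa act1 actM ME.
have autP := crossed_endoP Hb Aa act1 ME betaM beta1 (aut_mulH (H := H))
  (comul_aut (H := H)) (hom_counit_aut (hopf_coalgebraP H))
  (untwisted_act_aut act_weak).
split=> [|[tw norm /untwisted_cocycle_autP tauE]].
  rewrite tensE => /untwist_algebraP[/assocP[tw n1 coc] tM _].
  have tauE := proj1 autP tM; split; last exact/untwisted_cocycle_autP.
    exact/(twisted_moduleP act_weak tauE).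
  exact/(normal_cocycleP act tauE).
rewrite tensE; apply/untwist_algebraP; split.
- have [one1 tw'] := proj1 (twisted_moduleP act_weak tauE) tw.
  have [n1 coc] := proj1 (normal_cocycleP act tauE) norm.
  exact/assocP.
- exact/autP.
by rewrite [LHS]tensor_map_pure beta1 (hom_aut1 (hom_algebraP H)).
Qed.
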